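(* Let $G$ be a finite abelian group and let $F$ be a face of the group cone $\mathcal C(G)$. Let \[ H=\{0\}\cup\{h\in G\setminus\{0\} : x_h=0 \text{ for all } x\in F\}. \] Then $H$ is a subgroup of $G$, and there is a Kunz-balanced poset $\preceq$ on the quotient group $G/H$ such that for all $a,b\in G\setminus\{0\}$ with $a+b\neq 0$, the equation $x_a+x_b=x_{a+b}$ holds for every $x\in F$ if and only if $\bar a\preceq \bar a+\bar b$. (Here $\bar x$ denotes the image of $x\in G$ in $G/H$.)
   Context: For a finite abelian group $(G,+)$ with $m=|G|$, the group cone $\mathcal C(G)\subset\mathbb R^{m-1}$ (coordinates indexed by the nonzero elements of $G$) is the set of all $x$ satisfying $x_a+x_b\ge x_{a+b}$ for all $a,b\in G\setminus\{0\}$ with $a+b\neq 0$. A face of a polyhedron is an intersection of some collection of its facets. A Kunz-balanced poset on a finite abelian group $K$ is a partial order $\preceq$ on the set $K$ such that for all $a,b\in K$, $a\preceq b$ implies $b-a\preceq b$ (in particular $0$ is the unique minimal element). *)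

(* Defs.v *)
From mathcomp Require Import all_boot all_order all_algebra all_fingroup.
From mathcomp Require Import boolp classical_sets reals.

Set Implicit Arguments.
Unset Strict Implicit.
Unset Printing Implicit Defensive.

Import Order.TTheory GRing.Theory Num.Theory.
Local Open Scope classical_set_scope.
Local Open Scope ring_scope.

Section Polyhedra.
Variables (R : realType) (V : vectType R).
Implicit Types (P Q F : set V) (d : nat).

(* [A] is nonempty and its affine hull has dimension [d]: the hull is
   [x0 + U], where [U] is the least subspace containing [A - x0]. *)
Definition has_affine_dim (A : set V) d : Prop :=
  exists (x0 : V) (U : {vspace V}),
    [/\ A x0, \dim U = d,
        forall x, A x -> x - x0 \in U
      & forall W : {vspace V},
          (forall x, A x -> x - x0 \in W) -> (U <= W)%VS].

(* A facet is cut out of [P] by a valid linear inequality [c <= l x] and has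
   codimension one in [P]. *)
Definition is_facet P Q : Prop :=
  exists (l : {scalar V}) (c : R),
    [/\ forall x, P x -> c <= l x,
        Q = P `&` [set x | l x = c]
      & exists d, has_affine_dim P d.+1 /\ has_affine_dim Q d].

(* The intersection is taken inside [P], so that the empty collection of
   facets yields [P] itself. *)
Definition is_face P F : Prop :=
  exists2 facets : set (set V),
    facets `<=` is_facet P & F = P `&` \bigcap_(Q in facets) Q.

End Polyhedra.

Definition nonzero (G : finZmodType) := {a : G | a != 0}.

Definition nz (G : finZmodType) (a : G) (a_neq0 : a != 0) : nonzero G :=
  exist _ a a_neq0.

(* [R^o] rather than [R] is what gives this type its vector space structure. *)
Definition coord_space (R : realType) (G : finZmodType) :=
  {ffun nonzero G -> R^o}.

Definition group_cone (R : realType) (G : finZmodType) :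
    set (coord_space R G) :=
  [set x | forall (a b : G) (ha : a != 0) (hb : b != 0) (hab : a + b != 0),
             (x (nz hab) : R) <= x (nz ha) + x (nz hb)].

Definition zero_coords (R : realType) (G : finZmodType)
    (F : set (coord_space R G)) : {set G} :=
  0 |: [set val h | h in [set h : nonzero G | `[< forall x, F x -> x h = 0 >]]]%SET.

(* Finite groups are multiplicative here: for an abelian group [K],
   [b * a^-1] is the difference [b - a]. *)
Definition kunz_balanced (K : finGroupType) (le : rel K) : Prop :=
  [/\ reflexive le, antisymmetric le, transitive le
    & forall a b : K, le a b -> le (b * a^-1)%g b].

(* Main.v *)
Require Import Defs.
From mathcomp Require Import all_boot all_order all_algebra all_fingroup.
From mathcomp Require Import boolp classical_sets reals.
From mathcomp Require Import lra.

Set Implicit Arguments.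
Unset Strict Implicit.
Unset Printing Implicit Defensive.

Import Order.TTheory GRing.Theory Num.Theory FinRing.Theory.
Local Open Scope ring_scope.

(** Extend every [x] in the cone by [x_0 = 0].  When [|G| > 2] the extension is
    nonnegative: summing [x_(a+b) <= x_a + x_b] over [b != 0, -a] gives
    [x_(-a) <= (|G| - 1) x_a], hence [x_a <= (|G| - 1)^2 x_a].  Thus the
    extension is subadditive on all of [G], vanishing on [F] is stable under
    addition, and [x] descends to [G/H].  The order [a <= b] iff
    [x_a + x_(b-a) = x_b] on [F] is then Kunz-balanced; antisymmetry says that
    [x_(b-a) + x_(a-b) = 0] forces [b - a] into [H].  When [|G| <= 2] the cone
    is the whole space, the equations are void and the order with least
    element [0] and no other relation will do. *)

Section ExtendedCoordinates.
Variables (R : realType) (G : finZmodType).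
Implicit Types (x : coord_space R G) (a b : G).

Definition ext_coord x a : R :=
  if insub a is Some u then x (u : nonzero G) else 0.

Lemma ext_coord0 x : ext_coord x 0 = 0.
Proof. by rewrite /ext_coord insubF // eqxx. Qed.

Lemma ext_coord_nz x a (ha : a != 0) : ext_coord x a = x (nz ha).
Proof. by rewrite /ext_coord (insubT (fun a : G => a != 0) ha). Qed.

Lemma zero_coordsP (F : set (coord_space R G)) a :
  reflect (forall x, F x -> ext_coord x a = 0) (a \in zero_coords F).
Proof.
apply: (iffP setU1P) => [[->|/imsetP[[b hb]]]|H].
- by move=> x _; rewrite ext_coord0.
- by rewrite inE => /asboolP H -> x Fx; rewrite (ext_coord_nz _ hb) H.
have [->|ha] := eqVneq a 0; [by left | right].
apply/imsetP; exists (nz ha); rewrite // inE.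
by apply/asboolP => x Fx; rewrite -ext_coord_nz H.
Qed.

Section LargeGroup.
Hypothesis G_gt2 : (2 < #|G|)%N.
Variable x : coord_space R G.
Hypothesis Cx : group_cone x.

Lemma ext_coord_oppr_le a :
  a != 0 -> ext_coord x (- a) <= ext_coord x a *+ (#|G|).-1.
Proof.
move=> ha; pose f := ext_coord x.
have hNa : - a != 0 by rewrite oppr_eq0.
(* Taken at [c = a] and at [c = - a]: the two splittings of one total give [f (- a) - f a] as the
   difference of the two partial sums, which is at most [|G| - 2] times [f a]. *)
have tot c : c != 0 -> \sum_b f b = f c + \sum_(b | (b != 0) && (b != c)) f b.
  by move=> hc; rewrite (bigD1 0) //= {1}/f ext_coord0 add0r (bigD1 c).
(* Translation by [a] carries [0] to [a] and [- a] to [0], so it matches the two index sets. *)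
have shift : \sum_(b | (b != 0) && (b != a)) f b =
             \sum_(b | (b != 0) && (b != - a)) f (a + b).
  rewrite (reindex_inj (addrI a)) /=; apply: eq_bigl => b.
  by rewrite -[X in _ && (_ != X)]addr0 (inj_eq (addrI a)) addrC addr_eq0 andbC.
have le : \sum_(b | (b != 0) && (b != - a)) f (a + b) <=
          \sum_(b | (b != 0) && (b != - a)) (f a + f b).
  apply: ler_sum => b /andP[hb hba].
  have hab : a + b != 0 by rewrite addrC addr_eq0.
  by rewrite /f !ext_coord_nz; apply: Cx.
rewrite big_split /= -shift sumr_const in le.
have card : #|[pred b : G | (b != 0) && (b != - a)]| = (#|G|).-2.
  rewrite [in RHS](cardD1 0) [in RHS](cardD1 (- a)) !inE hNa /=.
  by apply: eq_card => b; rewrite !inE andbT andbC.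
have := tot _ ha; rewrite (tot _ hNa) -/f.
move: le; rewrite card.
have -> : (#|G|).-1 = (#|G|).-2.+1 by case: #|G| G_gt2 => [|[]].
rewrite mulrS; set u := \sum_(_ | _) f _; set v := \sum_(_ | _) f _.
rewrite -/(f a) -/(f (- a)); lra.
Qed.

Lemma ext_coord_ge0 a : 0 <= ext_coord x a.
Proof.
have [->|ha] := eqVneq a 0; first by rewrite ext_coord0.
have := @ext_coord_oppr_le (- a); rewrite oppr_eq0 opprK => /(_ ha) le1.
have le2 := ext_coord_oppr_le ha.
(* With a factor [n >= 2], a negative value [p] would satisfy [p <= n^2 p <= 4 p < p]. *)
have n2 : 2 <= (#|G|).-1%:R :> R.
  by rewrite ler_nat -ltnS prednK // (ltn_trans _ G_gt2).
move: le1 le2; rewrite -(mulr_natr (ext_coord x a)).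
rewrite -(mulr_natr (ext_coord x (- a))).
move: (ext_coord x a) (ext_coord x (- a)) (#|G|).-1%:R n2 => p q n n2 qp pq.
have n0 : 0 <= n by lra.
rewrite leNgt; apply/negP => plt0.
have qnp : q * n <= p * n * n by rewrite ler_wpM2r.
have pn : p * n <= p * 2 by rewrite ler_wnM2l // ltW.
have pnn : p * n * n <= p * 2 * n by rewrite ler_wpM2r.
lra.
Qed.

Lemma ext_coordD a b : ext_coord x (a + b) <= ext_coord x a + ext_coord x b.
Proof.
have [->|ha] := eqVneq a 0; first by rewrite add0r ext_coord0 add0r.
have [->|hb] := eqVneq b 0; first by rewrite addr0 ext_coord0 addr0.
(* The cone has no inequality with [a + b = 0]; nonnegativity supplies it. *)
have [->|hab] := eqVneq (a + b) 0.
  by rewrite ext_coord0 addr_ge0 // ext_coord_ge0.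
by rewrite !ext_coord_nz; apply: Cx.
Qed.

End LargeGroup.
End ExtendedCoordinates.

(** The elements [0], [a], [a + b] are distinct. Thus any instance of a cone inequality already
    places [G] in the large case. *)
Lemma nonzeroD_card_gt2 (G : finZmodType) (a b : G) :
  a != 0 -> b != 0 -> a + b != 0 -> (2 < #|G|)%N.
Proof.
move=> ha hb hab; have uniq3 : uniq [:: 0; a; a + b].
  rewrite /= !inE negb_or ![0 == _]eq_sym ha hab /= andbT.
  by rewrite -[X in X != _]addr0 (inj_eq (addrI a)) eq_sym.
by rewrite -[3%N](card_uniqP uniq3) max_card.
Qed.

(** The difference [b - a] is [b] when [a = 0], and [0] when [a = b]. *)
Lemma kunz_balanced_flat (K : finGroupType) :
  kunz_balanced (fun a b : K => (a == 1%g) || (a == b)).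
Proof.
split=> [a|a b|b a c|a b].
- by rewrite eqxx orbT.
- by case: (eqVneq a b) => // hab; rewrite !orbF => /andP[/eqP-> /eqP->].
- by case/predU1P=> [->|/eqP->] //; rewrite eqxx.
- by case/predU1P=> [->|/eqP->]; rewrite ?invg1 ?mulg1 ?mulgV eqxx ?orbT.
Qed.

(** In a finite group closure under addition suffices, and it follows from
    [0 <= x_(a+b) <= x_a + x_b = 0]. *)
Lemma zero_coords_group_set (R : realType) (G : finZmodType)
    (F : set (coord_space R G)) :
  (forall x, F x -> group_cone x) -> group_set (zero_coords F).
Proof.
move=> FC; apply/group_setP; split; first exact: setU11.
move=> a b; rewrite zmodMgE.
have [->|ha] := eqVneq a 0; first by rewrite add0r.
have [->|hb] := eqVneq b 0; first by rewrite addr0.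
have [->|hab] := eqVneq (a + b) 0; first by rewrite setU11.
have G_gt2 := nonzeroD_card_gt2 ha hb hab.
move=> /zero_coordsP Ha /zero_coordsP Hb; apply/zero_coordsP => x Fx.
apply/eqP; rewrite eq_le ext_coord_ge0 ?andbT //; last exact: FC.
by rewrite (le_trans (ext_coordD _ _ _ _)) ?Ha ?Hb ?addr0 //; apply: FC.
Qed.

Section QuotientOrder.
Variables (R : realType) (G : finZmodType) (F : set (coord_space R G)).
Hypothesis FC : forall x, F x -> group_cone x.
Hypothesis G_gt2 : (2 < #|G|)%N.
Variable H : {group G}.
Hypothesis HE : H = zero_coords F :> {set G}.
Implicit Types (a b : G) (A B : coset_of H).

Let in_norm a : a \in 'N(H)%g.
Proof.
have nHG := sub_abelian_norm (zmod_abelian _) (finset.subsetT H).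
exact: (fintype.subsetP nHG) (finset.in_setT a).
Qed.

Definition quo_coord (x : coord_space R G) A : R := ext_coord x (repr A).

(** The choice of [repr] is harmless: [x_(h+a) <= x_h + x_a = x_a] for [h] in [H], and adding [- h]
    gives the reverse inequality. *)
Lemma quo_coordE x a : F x -> quo_coord x (coset H a) = ext_coord x a.
Proof.
move=> Fx; have Cx := FC Fx; rewrite /quo_coord.
have := mem_repr_coset (coset H a); rewrite val_coset //.
case/rcosetP=> h Hh ->; rewrite zmodMgE.
have zeroH k : k \in H -> ext_coord x k = 0.
  by rewrite HE => /zero_coordsP; apply.
apply/eqP; rewrite eq_le; apply/andP; split.
  by rewrite (le_trans (ext_coordD _ _ _ _)) // zeroH // add0r.
rewrite -{1}[a](addKr h) (le_trans (ext_coordD _ _ _ _)) // zeroH ?add0r //.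
by rewrite -zmodVgE groupV.
Qed.

Lemma quo_coord1 x : F x -> quo_coord x 1%g = 0.
Proof.
by move=> Fx; rewrite -(coset_id (group1 H)) quo_coordE // ext_coord0.
Qed.

Lemma quo_coordM x A B :
  F x -> quo_coord x (A * B)%g <= quo_coord x A + quo_coord x B.
Proof.
move=> Fx; rewrite -(coset_reprK A) -(coset_reprK B) -morphM //.
by rewrite !quo_coordE // ext_coordD //; apply: FC.
Qed.

Lemma quo_coord_eq1 A : (forall x, F x -> quo_coord x A = 0) -> A = 1%g.
Proof.
move=> A0; rewrite -(coset_reprK A); apply: coset_id.
by move/zero_coordsP: A0; rewrite -HE.
Qed.

Definition quo_le : rel (coset_of H) := fun A B =>
  `[< forall x, F x ->
        quo_coord x A + quo_coord x (B * A^-1)%g = quo_coord x B >].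

Lemma kunz_balanced_quo_le : kunz_balanced quo_le.
Proof.
have quoC A B : (A * B = B * A)%g.
  by rewrite -(coset_reprK A) -(coset_reprK B) -!morphM // zmod_mulgC.
split=> [A|A B /andP[/asboolP AB /asboolP BA]||A B /asboolP AB].
- by apply/asboolP => x Fx; rewrite mulgV quo_coord1 ?addr0.
(* Adding the two equations leaves two nonnegative numbers with sum zero. *)
- apply/eqP; rewrite eq_mulgV1; apply/eqP/quo_coord_eq1 => x Fx.
  have := AB x Fx; have := BA x Fx.
  have : 0 <= quo_coord x (A * B^-1)%g by apply: ext_coord_ge0 => //; apply: FC.
  have : 0 <= quo_coord x (B * A^-1)%g by apply: ext_coord_ge0 => //; apply: FC.
  lra.
(* In additive notation, [x_C = x_A + x_(B-A) + x_(C-B) >= x_A + x_(C-A) >= x_C], so equality holds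
   throughout. *)
- move=> B A C /asboolP AB /asboolP BC; apply/asboolP => x Fx.
  have := AB x Fx; have := BC x Fx.
  have := quo_coordM A (C * A^-1)%g Fx; rewrite quoC mulgKV.
  have := quo_coordM (C * B^-1)%g (B * A^-1)%g Fx; rewrite mulgA mulgKV.
  lra.
(* Since [B - (B - A) = A], this is the equation of [AB] with its summands exchanged. *)
- apply/asboolP => x Fx; rewrite invMg invgK [(B * (A * _))%g]quoC mulgKV.
  by rewrite addrC AB.
Qed.

Lemma quo_leP a b (ha : a != 0) (hb : b != 0) (hab : a + b != 0) :
  (forall x, F x -> x (nz ha) + x (nz hb) = x (nz hab)) <->
  quo_le (coset H a) (coset H a * coset H b)%g.
Proof.
rewrite /quo_le -morphM // zmodMgE.
have -> : (coset H (a + b)%R * (coset H a)^-1 = coset H b)%g.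
  by rewrite addrC -zmodMgE morphM // mulgK.
split=> [E|/asboolP E x Fx].
  by apply/asboolP => x Fx; rewrite !quo_coordE // !ext_coord_nz E.
by have := E x Fx; rewrite !quo_coordE // !ext_coord_nz.
Qed.

End QuotientOrder.

Theorem theorem3p3 (R : realType) (G : finZmodType)
    (F : set (coord_space R G)) (hF : is_face (@group_cone R G) F) :
  exists H : {group G},
    (H : {set G}) = zero_coords F /\
    exists le : rel (coset_of H),
      kunz_balanced le /\
      forall (a b : G) (ha : a != 0) (hb : b != 0) (hab : a + b != 0),
        (forall x : coord_space R G, F x ->
           x (nz ha) + x (nz hb) = x (nz hab)) <->
        le (coset H a) (coset H a * coset H b)%g.
Proof.
have FC x : F x -> group_cone x by case: hF => facets _ -> [].
exists (group (zero_coords_group_set FC)); split=> //.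
have [G_gt2|G_le2] := ltnP 2 #|G|.
  eexists; split; first exact: (@kunz_balanced_quo_le R G F).
  by move=> a b ha hb hab; apply: quo_leP.
exists (fun A B => (A == 1%g) || (A == B)); split.
  exact: kunz_balanced_flat.
move=> a b ha hb hab.
by have := nonzeroD_card_gt2 ha hb hab; rewrite ltnNge G_le2.
Qed.
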